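(* Let $n \ge 3$ and $X \subseteq \{2,\ldots,n-1\}$. If $S$ is a Hamilton sequence for the restricted rotator graph $\mathrm{Rot}_{n-1}(X)$, then $\mathrm{reuse}_n(S)$ is a Hamilton sequence for the restricted rotator graph $\mathrm{Rot}_n(R)$, where $R = \{n\} \cup \{\, n - x + 1 : x \in X \,\}$.
   Context: $\Pi_k$ is the set of strings that are permutations of $\{1,\ldots,k\}$. For $2 \le r \le k$, the prefix-rotation $\sigma_r$ maps $a_1 \cdots a_k$ to $a_2 \cdots a_r a_1 a_{r+1} \cdots a_k$. For $R \subseteq \{2,\ldots,k\}$, $\mathrm{Rot}_k(R)$ is the directed graph with node set $\Pi_k$ and an arc from $\mathbf{a}$ to $\mathbf{b}$ whenever $\mathbf{b} = \mathbf{a}\sigma_r$ for some $r \in R$. A Hamilton sequence for $\mathrm{Rot}_k(R)$ is a sequence $r_1,\ldots,r_{k!}$ of elements of $R$ such that, with $v_0 = k\,(k{-}1)\cdots 1$ and $v_i = v_{i-1}\sigma_{r_i}$, the strings $v_0,\ldots,v_{k!-1}$ are pairwise distinct (hence all of $\Pi_k$) and $v_{k!} = v_0$. The reuse operation $\mathrm{reuse}_n(S)$ replaces each entry $r$ of a sequence $S$ by $n$ repeated $n-1$ times followed by $n+1-r$. *)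

(* Defs.v *)
From mathcomp Require Import all_boot finmap.

Set Implicit Arguments.
Unset Strict Implicit.
Unset Printing Implicit Defensive.

Definition is_perm_string (k : nat) : pred (seq nat) :=
  [pred a | perm_eq a (iota 1 k)].

(* Strings are 0-indexed here, so a_1 ... a_r is [take r a]; the value is only
   meaningful for 2 <= r <= size a. *)
Definition prefix_rot (a : seq nat) (r : nat) : seq nat :=
  rot 1 (take r a) ++ drop r a.

Definition rotator_arc (k : nat) (R : {fset nat}) : rel (seq nat) :=
  fun a b => [&& is_perm_string k a, is_perm_string k b
               & has (fun r => b == prefix_rot a r) (enum_fset R)].

Definition start_string (k : nat) : seq nat := rev (iota 1 k).

(* The string v_i reached from v_0 after applying the first i entries of S. *)
Definition visited (k : nat) (S : seq nat) (i : nat) : seq nat :=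
  foldl prefix_rot (start_string k) (take i S).

(* The set R is meant to be a subset of {2, ..., k}; [hamilton_sequence_nodes]
   and [hamilton_sequence_arcs] below relate this to Hamilton cycles of the
   digraph with nodes [is_perm_string k] and arcs [rotator_arc k R]. *)
Definition hamilton_sequence (k : nat) (R : {fset nat}) (S : seq nat) : Prop :=
  [/\ size S = k`!,
      {subset S <= R},
      uniq [seq visited k S i | i <- iota 0 k`!]
    & visited k S k`! = start_string k].

Definition reuse (n : nat) (S : seq nat) : seq nat :=
  flatten [seq rcons (nseq (n - 1) n) (n + 1 - r) | r <- S].

Lemma perm_prefix_rot a r : perm_eq (prefix_rot a r) a.
Proof. by rewrite -{2}(cat_take_drop r a) perm_cat2r perm_rot. Qed.

Lemma perm_visited k S i : is_perm_string k (visited k S i).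
Proof.
rewrite /is_perm_string /visited /=.
have: perm_eq (start_string k) (iota 1 k) by rewrite perm_rev.
elim: (take i S) (start_string k) => [|r s IHs] a //= a_perm.
by apply: IHs; apply: perm_trans a_perm; exact: perm_prefix_rot.
Qed.

Lemma hamilton_sequence_nodes k R S : hamilton_sequence k R S ->
  [seq visited k S i | i <- iota 0 k`!] =i is_perm_string k.
Proof.
case=> _ _ uniq_v _.
have in_perms a : (a \in permutations (iota 1 k)) = is_perm_string k a.
  exact: mem_permutations.
have sub_v : {subset [seq visited k S i | i <- iota 0 k`!]
                <= permutations (iota 1 k)}.
  by move=> a /mapP[i _ ->]; rewrite in_perms perm_visited.
have [|_ eq_v] := uniq_min_size uniq_v sub_v.
  by rewrite size_map size_iota size_permutations ?iota_uniq // size_iota.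
by move=> a; rewrite eq_v in_perms.
Qed.

Lemma hamilton_sequence_arcs k R S i : hamilton_sequence k R S -> i < k`! ->
  rotator_arc k R (visited k S i) (visited k S i.+1).
Proof.
case=> size_S S_R _ _ lt_i; rewrite /rotator_arc !perm_visited /=.
apply/hasP; exists (nth 0 S i); first by apply/S_R/mem_nth; rewrite size_S.
by rewrite /visited (take_nth 0) ?size_S // -cats1 foldl_cat.
Qed.

(* Main.v *)
Require Import Defs.
From mathcomp Require Import all_boot finmap.

(** Write [lifted n c] for the string [n] followed by the reversal of [c] with
    each symbol [x] relabelled [n - x].  Starting from [lifted n c], the
    rotations [n, ..., n] ([n - 1] times) run through all cyclic shifts of this
    string, and the closing entry [n + 1 - r] leads to [lifted n (c sigma_r)].
    Hence [reuse_n(S)] visits exactly the cyclic shifts of the lifts of the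
    strings visited by [S]; these are distinct since the position of [n]
    determines the shift and [lifted n] is injective on permutations. *)

Definition lifted (n : nat) (c : seq nat) : seq nat :=
  n :: [seq n - x | x <- rev c].

(** Serves both for the rotation of [c] and for the closing rotation of a block: [x] lands between
    [d] and [e]. *)
Lemma prefix_rot_cons_cat x d e :
  prefix_rot (x :: d ++ e) (size d).+1 = d ++ x :: e.
Proof.
by rewrite /prefix_rot /= take_size_cat // drop_size_cat // rot1_cons cat_rcons.
Qed.

Lemma prefix_rot_size a : prefix_rot a (size a) = rot 1 a.
Proof. by rewrite /prefix_rot take_size drop_size cats0. Qed.

(** [rot j] is the [j]-th power of [rot 1] only up to the length, hence the bound on [j]. *)
Lemma foldl_prefix_rot_nseq a j : j <= size a ->
  foldl prefix_rot a (nseq j (size a)) = rot j a.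
Proof.
elim: j => [|j IHj] lt_j; first by rewrite rot0.
rewrite -addn1 nseqD foldl_cat IHj ?(ltnW lt_j) //=.
by rewrite -{1}(size_rot j a) prefix_rot_size -rotS // addn1.
Qed.

Lemma foldl_prefix_rot_lift n c j : 0 < n -> size c = n - 1 -> j <= n ->
  foldl prefix_rot (lifted n c) (nseq j n) = rot j (lifted n c).
Proof.
move=> n_gt0 size_c le_jn.
have size_l : size (lifted n c) = n.
  by rewrite /= size_map size_rev size_c subn1 prednK.
by rewrite -{2}size_l foldl_prefix_rot_nseq ?size_l.
Qed.

(** Let [c = x d e] with [size d = r - 1], let [f x = n - x], and let primes denote reversal and
    relabelling by [f]. The lift [n e' d' (f x)] becomes [(f x) n e' d'] after [n - 1] shifts; the
    closing rotation moves [f x] past [n e'], giving [n e' (f x) d'], the lift of [d x e]. *)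
Lemma foldl_reuse_block n c r : size c = n - 1 -> 0 < r <= n - 1 ->
  foldl prefix_rot (lifted n c) (rcons (nseq (n - 1) n) (n + 1 - r))
  = lifted n (prefix_rot c r).
Proof.
case: n => [|n]; first by rewrite sub0n leqn0 lt0n andNb.
rewrite subn1 /= => size_c /andP[r_gt0 le_rn].
rewrite -cats1 foldl_cat foldl_prefix_rot_lift ?subn1 //=.
case: c size_c => [|x c] /= size_c.
  by rewrite -size_c leqNgt r_gt0 in le_rn.
case: r r_gt0 le_rn => // r _ lt_rn.
have le_rc : r <= size c by rewrite -ltnS size_c.
rewrite -(cat_take_drop r c); set d := take r c; set e := drop r c.
have size_d : size d = r by rewrite size_takel.
have size_e : size e = n - r.+1 by rewrite size_drop -size_c subSS.
rewrite -{2}size_d prefix_rot_cons_cat /lifted.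
set f := subn n.+1.
rewrite rev_cons rev_cat map_rcons !map_cat rev_cat rev_cons map_cat map_rcons.
set d' := map f (rev d); set e' := map f (rev e).
have -> : rot n (n.+1 :: rcons (e' ++ d') (f x)) = f x :: (n.+1 :: e') ++ d'.
  have size_ed : size (n.+1 :: e' ++ d') = n.
    rewrite /= size_cat !size_map !size_rev size_d size_e -addnS.
    by rewrite subnK // -size_d.
  by rewrite -rcons_cons -cats1 -{1}size_ed rot_size_cat.
have -> : n.+1 + 1 - r.+1 = (size (n.+1 :: e')).+1.
  by rewrite /= size_map size_rev size_e addn1 -subSn // -subSn ?subSS // ltnW.
by rewrite prefix_rot_cons_cat /= cat_rcons.
Qed.

Lemma foldl_reuse n c S : size c = n - 1 -> {in S, forall r, 0 < r <= n - 1} ->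
  foldl prefix_rot (lifted n c) (reuse n S) = lifted n (foldl prefix_rot c S).
Proof.
elim: S c => //= r S IHS c size_c S_bd.
rewrite /reuse /= foldl_cat foldl_reuse_block ?S_bd ?mem_head //.
rewrite IHS // => [|s sS]; last by rewrite S_bd // mem_behead.
by rewrite (perm_size (perm_prefix_rot _ _)).
Qed.

(** The two reversals cancel, and relabelling turns [1, ..., n - 1] into descending order. *)
Lemma lift_start n : 0 < n -> lifted n (start_string (n - 1)) = start_string n.
Proof.
case: n => // n _; rewrite subn1 /= /lifted /start_string revK.
rewrite -addn1 iotaD rev_cat /= add1n addn1; congr cons.
apply: (@eq_from_nth _ 0) => [|i]; rewrite size_map size_iota.
  by rewrite size_rev size_iota.
move=> lt_in; rewrite (nth_map 0) ?size_iota // nth_rev ?size_iota //.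
have lt_rev : n - i.+1 < n by rewrite ltn_subrL (leq_ltn_trans _ lt_in).
by rewrite !nth_iota // !add1n subSS -subSn // subSS.
Qed.

Lemma size_reuse n S : 0 < n -> size (reuse n S) = size S * n.
Proof.
move=> n_gt0; elim: S => // r S IHS.
by rewrite /reuse /= size_cat IHS size_rcons size_nseq subn1 prednK // mulSn.
Qed.

(** Blocks have length [n]; as [j < n], the cut falls before the closing entry of block [i]. *)
Lemma take_reuse n S i j : i < size S -> j < n ->
  take (i * n + j) (reuse n S) = reuse n (take i S) ++ nseq j n.
Proof.
move=> lt_i lt_j; have n_gt0 : 0 < n by apply: leq_ltn_trans lt_j.
rewrite -{1}(cat_take_drop i S) {1}/reuse map_cat flatten_cat take_cat.
rewrite -/(reuse n _) size_reuse // size_takel ?(ltnW lt_i) //.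
rewrite ltnNge leq_addr /= addKn (drop_nth 0) //= takel_cat; last first.
  by rewrite size_rcons size_nseq subn1 prednK // ltnW.
by rewrite -cats1 takel_cat ?size_nseq ?take_nseq // subn1 -ltnS prednK.
Qed.

Lemma visited_reuse n S i j :
  {in S, forall r, 0 < r <= n - 1} -> i < size S -> j < n ->
  visited n (reuse n S) (i * n + j) = rot j (lifted n (visited (n - 1) S i)).
Proof.
move=> S_bd lt_i lt_j; have n_gt0 : 0 < n by apply: leq_ltn_trans lt_j.
rewrite /visited take_reuse // foldl_cat -lift_start // foldl_reuse.
- rewrite foldl_prefix_rot_lift ?(ltnW lt_j) //.
  by rewrite (perm_size (perm_visited (n - 1) S i)) size_iota.
- by rewrite size_rev size_iota.
- by move=> r /mem_take; apply: S_bd.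
Qed.

Lemma index_rot_cons (T : eqType) (x : T) s j : x \notin s -> j <= size s ->
  index x (rot j (x :: s)) = if j == 0 then 0 else (size s).+1 - j.
Proof.
case: j => [|j] xNs lt_j; first by rewrite rot0 /= eqxx.
rewrite /rot /= index_cat (contraNF (@mem_drop _ _ _ _) xNs) /= eqxx addn0.
by rewrite size_drop subSS.
Qed.

Lemma rot_cons_inj (T : eqType) (x : T) s1 s2 j1 j2 :
  x \notin s1 -> x \notin s2 -> j1 <= size s1 -> j2 <= size s2 ->
  rot j1 (x :: s1) = rot j2 (x :: s2) -> j1 = j2 /\ s1 = s2.
Proof.
move=> xNs1 xNs2 le_j1 le_j2 eq_rot.
have [eq_sz] : size (x :: s1) = size (x :: s2).
  by rewrite -(size_rot j1) eq_rot size_rot.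
have eq_j : j1 = j2.
  have := congr1 (index x) eq_rot; rewrite !index_rot_cons // eq_sz.
  rewrite eq_sz in le_j1.
  (* A zero shift leaves [x] at index 0, a nonzero one puts it at a positive index. *)
  case: j1 j2 le_j1 le_j2 {eq_rot} => [|j1] [|j2] //= le_j1 le_j2.
  - by rewrite subSS => /esym/eqP; rewrite subn_eq0 leqNgt le_j2.
  - by rewrite subSS => /eqP; rewrite subn_eq0 leqNgt le_j1.
  - by move/eqP; rewrite eqn_sub2lE ?leqW // => /eqP.
by split=> //; move: eq_rot; rewrite eq_j => /rot_inj[].
Qed.

(** The bounds make truncated subtraction from [n] an involution on the symbols. *)
Lemma lift_inj n a b : {in a, forall x, x <= n} -> {in b, forall x, x <= n} ->
  lifted n a = lifted n b -> a = b.
Proof.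
have K c : {in c, forall x, x <= n} ->
    rev (map (subn n) (map (subn n) (rev c))) = c.
  move=> c_le; rewrite -map_comp map_id_in ?revK // => x.
  by rewrite mem_rev => /c_le /subKn.
by move=> /K a_le /K b_le [eq_ab]; rewrite -a_le eq_ab b_le.
Qed.

Lemma perm_string_bounds n c : 0 < n -> is_perm_string (n - 1) c ->
  {in c, forall x, 0 < x < n}.
Proof.
move=> n_gt0 c_perm x; rewrite (perm_mem c_perm) mem_iota.
by rewrite add1n subn1 prednK.
Qed.

(** Symbols [x > 0] are relabelled below [n], so the leading [n] occurs only once and marks the
    shift. *)
Lemma rot_lift_inj n a b i j : 0 < n ->
  is_perm_string (n - 1) a -> is_perm_string (n - 1) b -> i < n -> j < n ->
  rot i (lifted n a) = rot j (lifted n b) -> i = j /\ a = b.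
Proof.
move=> n_gt0 a_perm b_perm lt_i lt_j.
have nN c : is_perm_string (n - 1) c -> n \notin [seq n - x | x <- rev c].
  move=> /(perm_string_bounds _ _ n_gt0) c_bd; apply/mapP=> -[x].
  rewrite mem_rev => /c_bd/andP[x_gt0 lt_xn] eq_n.
  by have := ltn_subrL x n; rewrite -eq_n ltnn x_gt0 n_gt0.
have le_n c : is_perm_string (n - 1) c -> {in c, forall x, x <= n}.
  by move=> /(perm_string_bounds _ _ n_gt0) c_bd x /c_bd/andP[_ /ltnW].
have size_s c : is_perm_string (n - 1) c ->
    size [seq n - x | x <- rev c] = n.-1.
  by move=> c_perm; rewrite size_map size_rev (perm_size c_perm) size_iota subn1.
have le_pred k : k < n -> k <= n.-1 by rewrite -(ltnS k) prednK.
case/rot_cons_inj; rewrite ?nN ?size_s ?le_pred // => -> eq_ab; split=> //.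
by apply: (@lift_inj n); rewrite /lifted ?eq_ab //; apply: le_n.
Qed.

Theorem theorem2 (n : nat) (X : {fset nat}) (S : seq nat) :
  3 <= n ->
  (forall x : nat, x \in X -> 2 <= x <= n - 1) ->
  hamilton_sequence (n - 1) X S ->
  hamilton_sequence n (n |` [fset (n - x + 1)%N | x in X])%fset (reuse n S).
Proof.
move=> n_ge3 X_bd [size_S S_X uniq_v v_last].
have n_gt0 : 0 < n by apply: leq_trans n_ge3.
have S_bd : {in S, forall r, 0 < r <= n - 1}.
  by move=> r /S_X/X_bd/andP[/ltnW-> ->].
have fact_n : n`! = size S * n.
  by rewrite size_S subn1 mulnC -{1 2}(prednK n_gt0) factS.
have v0_lift : start_string n = lifted n (start_string (n - 1)).
  by rewrite lift_start.
split.
- by rewrite size_reuse.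
- move=> r /flatten_mapP[x xS]; rewrite mem_rcons inE => /predU1P[->|].
    apply/fset1UP; right; apply/imfsetP; exists x; first exact: S_X.
    have /andP[_ le_x] := S_bd x xS.
    (* Under truncated subtraction, [n + 1 - x] and [n - x + 1] agree because [x <= n]. *)
    by rewrite addnBAC // (leq_trans le_x) // leq_subr.
  by rewrite mem_nseq => /andP[_ /eqP->]; apply/fset1UP; left.
- rewrite -size_S in uniq_v; move/mkseq_uniqP: uniq_v => v_inj.
  rewrite fact_n; apply/mkseq_uniqP => s t.
  rewrite !inE => lt_s lt_t.
  (* The quotient is the block number, the remainder the shift within the block. *)
  rewrite [s](divn_eq s n) [t](divn_eq t n).
  rewrite !visited_reuse ?ltn_mod ?ltn_divLR //.
  (* Remainders agree by the position of [n], quotients because [S] visits distinct strings. *)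
  case/rot_lift_inj=> [||||| -> /v_inj->]; rewrite ?ltn_mod ?perm_visited //.
  + by rewrite inE ltn_divLR.
  + by rewrite inE ltn_divLR.
(* The full sequence ends at the lift of the last string reached by [S], which is its start. *)
- rewrite /visited fact_n -(size_reuse _ _ n_gt0) take_size v0_lift.
  rewrite foldl_reuse ?size_rev ?size_iota //.
  by move: v_last; rewrite /visited -size_S take_size => ->.
Qed.
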